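(* Let $N\ge1$ and for each $i\in\{1,\dots,N\}$ consider the closed-loop subsystem $$x_i(t+1)=(A_i+B_iK_i)x_i(t)+\tilde u_i(t),\qquad y_i(t)=C_ix_i(t),$$ where $A_i\in\mathbb{R}^{n_{xi}\times n_{xi}}$, $B_i\in\mathbb{R}^{n_{xi}\times n_{ui}}$, $C_i\in\mathbb{R}^{n_{yi}\times n_{xi}}$ and $K_i\in\mathbb{R}^{n_{ui}\times n_{xi}}$ is a given local gain. Suppose each closed-loop subsystem is $\mathcal{X}_i$-dissipative from $\tilde u_i$ to $y_i$ with $\mathcal{X}_i=\mathcal{X}_i^\top=[\mathcal{X}_i^{kl}]_{k,l\in\{1,2\}}$ and $\mathcal{X}_i^{11}>0$. Let $\tilde u_i(t)=B_i\bar u_i(t)+w_i(t)$ with the distributed global controller $\bar u_i(t)=\sum_{j=1}^NK_{ij}y_j(t)$, and let $w=[w_i^\top]_{i}^\top$, $y=[y_i^\top]_i^\top$, $z=y$, $K=[K_{ij}]_{i,j=1}^N$. Suppose $\bar K=[\bar K_{ij}]_{i,j=1}^N$ (with $\bar K_{ij}\in\mathbb{R}^{n_{ui}\times n_{yj}}$), a symmetric matrix $\mathcal{Y}=[\mathcal{Y}^{kl}]_{k,l\in\{1,2\}}$, and scalars $p_1,\dots,p_N$ are feasible for (in particular, if they solve) the problem of minimizing $J=\|\bar K\|_1-\phi([p_i]_{i})+\psi(\mathcal{Y})$ subject to $p_i>0$ for all $i$, $\mathcal{Y}^{22}<0$, and $$\begin{bmatrix}\mathcal{X}_p^{11}&\mathbf{0}&\mathcal{X}^{11}B\bar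 K&\mathcal{X}_p^{11}\\ \star&-\mathcal{Y}^{22}&-\mathcal{Y}^{22}&\mathbf{0}\\ \star&\star&-\mathcal{H}(\mathcal{X}^{21}B\bar K)-\mathcal{X}_p^{22}&-\mathcal{X}_p^{21}+\mathcal{Y}^{21}\\ \star&\star&\star&\mathcal{Y}^{11}\end{bmatrix}\ge 0 .$$ Then, with $K_{ij}=p_i^{-1}\bar K_{ij}$ for all $i,j$, the closed-loop networked system with input $w$ and output $z$ is $\mathcal{Y}$-dissipative from $w$ to $z$.
   Context: Notation: $\mathcal{X}_p^{kl}=\mathrm{diag}([p_i\mathcal{X}_i^{kl}]_{i=1}^N)$ and $\mathcal{X}^{kl}=\mathrm{diag}([\mathcal{X}_i^{kl}]_{i=1}^N)$ for $k,l\in\{1,2\}$, $B=\mathrm{diag}([B_i]_{i=1}^N)$ (block diagonal matrices); $\mathcal{H}(M)=M+M^\top$; $\star$ denotes blocks determined by symmetry; $\|\cdot\|_1$ is the entrywise $\ell_1$ norm; $\phi,\psi$ are user-chosen real-valued functions used only in the objective. $\mathcal{Y}^{11}$ has the size of $w$ and $\mathcal{Y}^{22}$ the size of $z$. Matrix inequalities are between symmetric matrices ($>0$ positive definite, $\ge0$ positive semidefinite). Dissipativity: a discrete-time system $x(t+1)=f(x(t),u(t))$, $y(t)=h(x(t),u(t))$ is $\mathcal{X}$-dissipative from $u$ to $y$, where $\mathcal{X}=\mathcal{X}^\top=[\mathcal{X}^{kl}]_{k,l\in\{1,2\}}$, if there is a storage function $V$ of the state with $V(0)=0$, $V(x)>0$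 for all $x\ne 0$, and $$V(x(t+1))-V(x(t))\le\begin{bmatrix}u(t)\\ y(t)\end{bmatrix}^\top\begin{bmatrix}\mathcal{X}^{11}&\mathcal{X}^{12}\\ \mathcal{X}^{21}&\mathcal{X}^{22}\end{bmatrix}\begin{bmatrix}u(t)\\ y(t)\end{bmatrix}$$ for all $t\in\{0,1,2,\dots\}$, all input sequences and all corresponding trajectories. The state of the networked system is $x=[x_i^\top]_i^\top$. *)

(* Defs.v *)
From mathcomp Require Export all_boot all_order all_algebra reals.

Set Implicit Arguments.
Unset Strict Implicit.
Unset Printing Implicit Defensive.

Import Order.TTheory GRing.Theory Num.Theory.
Local Open Scope ring_scope.

Definition quadform (R : realType) (n : nat) (M : 'M[R]_n) (v : 'cV[R]_n) : R :=
  (v^T *m M *m v) 0 0.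

Definition posdefmx (R : realType) (n : nat) (M : 'M[R]_n) : Prop :=
  M \is symmetricmx /\ forall v : 'cV[R]_n, v != 0 -> 0 < quadform M v.

Definition psdmx (R : realType) (n : nat) (M : 'M[R]_n) : Prop :=
  M \is symmetricmx /\ forall v : 'cV[R]_n, 0 <= quadform M v.

Definition symmpart (R : realType) (n : nat) (M : 'M[R]_n) : 'M[R]_n := M + M^T.

Definition l1norm (R : realType) (m n : nat) (M : 'M[R]_(m, n)) : R :=
  \sum_(i < m) \sum_(j < n) `|M i j|.

(* The library's [mxdiag] only accepts square blocks; this is the same
   construction with rectangular ones.  [conform_mx 0] is only a type cast:
   on the diagonal the dimensions agree and it returns its argument. *)
Definition blkdiag (R : realType) (N : nat) (m n : 'I_N -> nat)
    (M : forall i, 'M[R]_(m i, n i)) : 'M[R]_(\sum_i m i, \sum_i n i) :=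
  \mxblock_(i, j) (if i == j then conform_mx 0 (M i) else 0).

Lemma blkdiag_square (R : realType) (N : nat) (n : 'I_N -> nat)
    (M : forall i, 'M[R]_(n i)) :
  blkdiag M = \mxdiag_i M i.
Proof. by []. Qed.

Lemma blkdiagK (R : realType) (N : nat) (m n : 'I_N -> nat)
    (M : forall i, 'M[R]_(m i, n i)) (i j : 'I_N) :
  submxblock (blkdiag M) i j = if i == j then conform_mx 0 (M i) else 0.
Proof. by rewrite mxblockK. Qed.

Lemma blkdiagK_eq (R : realType) (N : nat) (m n : 'I_N -> nat)
    (M : forall i, 'M[R]_(m i, n i)) (i : 'I_N) :
  submxblock (blkdiag M) i i = M i.
Proof. by rewrite blkdiagK eqxx conform_mx_id. Qed.

(* The symmetric completion of the upper triangle of a 4 x 4 block matrix. *)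
Definition symblock4 (R : realType) (a b c d : nat)
    (M11 : 'M[R]_a) (M12 : 'M[R]_(a, b)) (M13 : 'M[R]_(a, c)) (M14 : 'M[R]_(a, d))
    (M22 : 'M[R]_b) (M23 : 'M[R]_(b, c)) (M24 : 'M[R]_(b, d))
    (M33 : 'M[R]_c) (M34 : 'M[R]_(c, d))
    (M44 : 'M[R]_d) : 'M[R]_((a + b) + (c + d)) :=
  block_mx
    (block_mx M11   M12
              M12^T M22)
    (block_mx M13   M14
              M23   M24)
    (block_mx M13^T M23^T
              M14^T M24^T)
    (block_mx M33   M34
              M34^T M44).

(* The system x(t+1) = f (x t) (u t), y(t) = h (x t) (u t) with supply matrix
   [X] acting on [u; y]. *)
Definition dissipative (R : realType) (nx nu ny : nat)
    (f : 'cV[R]_nx -> 'cV[R]_nu -> 'cV[R]_nx)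
    (h : 'cV[R]_nx -> 'cV[R]_nu -> 'cV[R]_ny)
    (X : 'M[R]_(nu + ny)) : Prop :=
  exists V : 'cV[R]_nx -> R,
    [/\ V 0 = 0,
        forall x, x != 0 -> 0 < V x
      & forall (u : nat -> 'cV[R]_nu) (x : nat -> 'cV[R]_nx),
          (forall t, x t.+1 = f (x t) (u t)) ->
          forall t, V (x t.+1) - V (x t)
                    <= quadform X (col_mx (u t) (h (x t) (u t)))].

Section Network.
Context (R : realType) (N : nat) (nx nu ny : 'I_N -> nat).
Context (A : forall i, 'M[R]_(nx i)) (B : forall i, 'M[R]_(nx i, nu i))
        (C : forall i, 'M[R]_(ny i, nx i)) (K : forall i, 'M[R]_(nu i, nx i)).

Definition sub_step (i : 'I_N) (x u : 'cV[R]_(nx i)) : 'cV[R]_(nx i) :=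
  (A i + B i *m K i) *m x + u.

Definition sub_out (i : 'I_N) (x u : 'cV[R]_(nx i)) : 'cV[R]_(ny i) := C i *m x.

Context (Kg : forall i j, 'M[R]_(nu i, ny j)).

Arguments sub_step i x u : clear implicits.
Arguments sub_out i x u : clear implicits.

Definition net_out (x w : 'cV[R]_(\sum_i nx i)) : 'cV[R]_(\sum_i ny i) :=
  \mxcol_i sub_out i (submxcol x i) (submxcol w i).

Definition net_ctrl (i : 'I_N) (y : 'cV[R]_(\sum_j ny j)) : 'cV[R]_(nu i) :=
  \sum_j Kg i j *m submxcol y j.

Definition net_step (x w : 'cV[R]_(\sum_i nx i)) : 'cV[R]_(\sum_i nx i) :=
  \mxcol_i sub_step i (submxcol x i)
             (B i *m net_ctrl i (net_out x w) + submxcol w i).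

End Network.

Arguments sub_step {R N nx nu} A B K i x u.
Arguments sub_out {R N nx ny} C i x u.

Section Design.
Context (R : realType) (N : nat) (nx nu ny : 'I_N -> nat).
Context (B : forall i, 'M[R]_(nx i, nu i))
        (X : forall i, 'M[R]_(nx i + ny i)).

(* X^{kl} is [ulsubmx], [ursubmx], [dlsubmx], [drsubmx] for kl = 11, 12, 21, 22. *)
Definition design_lmi (Kb : forall i j, 'M[R]_(nu i, ny j))
    (Y : 'M[R]_(\sum_i nx i + \sum_i ny i)) (p : 'I_N -> R) :
    'M[R]_((\sum_i nx i + \sum_i ny i) + (\sum_i ny i + \sum_i nx i)) :=
  let Bd : 'M[R]_(\sum_i nx i, \sum_i nu i) := blkdiag B in
  let Kbar : 'M[R]_(\sum_i nu i, \sum_i ny i) := \mxblock_(i, j) Kb i j in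
  let X11 : 'M[R]_(\sum_i nx i) := blkdiag (fun i => ulsubmx (X i)) in
  let X21 : 'M[R]_(\sum_i ny i, \sum_i nx i) :=
    blkdiag (fun i => dlsubmx (X i)) in
  let Xp11 : 'M[R]_(\sum_i nx i) := blkdiag (fun i => p i *: ulsubmx (X i)) in
  let Xp21 : 'M[R]_(\sum_i ny i, \sum_i nx i) :=
    blkdiag (fun i => p i *: dlsubmx (X i)) in
  let Xp22 : 'M[R]_(\sum_i ny i) := blkdiag (fun i => p i *: drsubmx (X i)) in
  let Y11 : 'M[R]_(\sum_i nx i) := ulsubmx Y in
  let Y21 : 'M[R]_(\sum_i ny i, \sum_i nx i) := dlsubmx Y in
  let Y22 : 'M[R]_(\sum_i ny i) := drsubmx Y in
  symblock4
    Xp11  0        (X11 *m Bd *m Kbar)                     Xp11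
          (- Y22)  (- Y22)                                 0
                   (- symmpart (X21 *m Bd *m Kbar) - Xp22) (- Xp21 + Y21)
                                                           Y11.

Definition design_feasible (Kb : forall i j, 'M[R]_(nu i, ny j))
    (Y : 'M[R]_(\sum_i nx i + \sum_i ny i)) (p : 'I_N -> R) : Prop :=
  [/\ Y \is symmetricmx,
      forall i, 0 < p i,
      posdefmx (- drsubmx Y)
    & psdmx (design_lmi Kb Y p)].

Context (phi : ('I_N -> R) -> R)
        (psi : 'M[R]_(\sum_i nx i + \sum_i ny i) -> R).

Definition design_cost (Kb : forall i j, 'M[R]_(nu i, ny j))
    (Y : 'M[R]_(\sum_i nx i + \sum_i ny i)) (p : 'I_N -> R) : R :=
  l1norm (\mxblock_(i, j) Kb i j) - phi p + psi Y.

Definition design_optimal (Kb : forall i j, 'M[R]_(nu i, ny j))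
    (Y : 'M[R]_(\sum_i nx i + \sum_i ny i)) (p : 'I_N -> R) : Prop :=
  design_feasible Kb Y p /\
  forall Kb' Y' p', design_feasible Kb' Y' p' ->
    design_cost Kb Y p <= design_cost Kb' Y' p'.

End Design.

(* Main.v *)
(* The storage function of the network is the p-weighted sum of the local ones,
   so its increment is at most the p-weighted sum of the local supply rates.
   Block-diagonal matrices make X^{11} B Kbar = X_p^{11} B K, and likewise for
   X^{21}; hence the quadratic form of the LMI at (-u~, -y, y, w), with
   u~ = B K y + w, is exactly the network supply rate minus that sum. *)

Require Import Defs.
From mathcomp Require Import lra.

Set Implicit Arguments.
Unset Strict Implicit.
Unset Printing Implicit Defensive.

Import Order.TTheory GRing.Theory Num.Theory.
Local Open Scope ring_scope.

(** Unlike [quadform], this takes two vectors and a rectangular matrix, as off-diagonal blocks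
    require; [quadform M v] is convertible to [bilinform v M v]. *)
Definition bilinform (R : realType) (m n : nat)
    (u : 'cV[R]_m) (M : 'M[R]_(m, n)) (v : 'cV[R]_n) : R :=
  (u^T *m M *m v) 0 0.

Section BilinearForm.
Context {R : realType} {m n : nat}.
Implicit Types (u : 'cV[R]_m) (M : 'M[R]_(m, n)) (v : 'cV[R]_n).

Lemma bilinform_tr u M v : bilinform v M^T u = bilinform u M v.
Proof. by rewrite /bilinform -[u^T *m M *m v]trmxK [in RHS]mxE !trmx_mul trmxK mulmxA. Qed.

Lemma bilinformDl u u' M v :
  bilinform (u + u') M v = bilinform u M v + bilinform u' M v.
Proof. by rewrite /bilinform linearD !mulmxDl mxE. Qed.

Lemma bilinformDr u M v v' :
  bilinform u M (v + v') = bilinform u M v + bilinform u M v'.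
Proof. by rewrite /bilinform mulmxDr mxE. Qed.

Lemma bilinformDm u M M' v :
  bilinform u (M + M') v = bilinform u M v + bilinform u M' v.
Proof. by rewrite /bilinform mulmxDr mulmxDl mxE. Qed.

Lemma bilinformNl u M v : bilinform (- u) M v = - bilinform u M v.
Proof. by rewrite /bilinform linearN !mulNmx mxE. Qed.

Lemma bilinformNr u M v : bilinform u M (- v) = - bilinform u M v.
Proof. by rewrite /bilinform mulmxN mxE. Qed.

Lemma bilinformNm u M v : bilinform u (- M) v = - bilinform u M v.
Proof. by rewrite /bilinform mulmxN mulNmx mxE. Qed.

Lemma bilinformZm a u M v : bilinform u (a *: M) v = a * bilinform u M v.
Proof. by rewrite /bilinform -scalemxAr -scalemxAl mxE. Qed.

Lemma bilinform0m u v : bilinform u 0 v = 0.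
Proof. by rewrite /bilinform mulmx0 mul0mx mxE. Qed.

End BilinearForm.

Lemma bilinform_block (R : realType) (a b c d : nat) (Mul : 'M[R]_(a, c))
    (Mur : 'M[R]_(a, d)) (Mdl : 'M[R]_(b, c)) (Mdr : 'M[R]_(b, d))
    (u : 'cV[R]_a) (v : 'cV[R]_b) (w : 'cV[R]_c) (z : 'cV[R]_d) :
  bilinform (col_mx u v) (block_mx Mul Mur Mdl Mdr) (col_mx w z) =
  bilinform u Mul w + bilinform u Mur z
  + (bilinform v Mdl w + bilinform v Mdr z).
Proof.
rewrite /bilinform -mulmxA mul_block_col tr_col_mx mul_row_col.
by rewrite !mulmxDr !mulmxA !mxE.
Qed.

Lemma quadform_sym_block (R : realType) (m n : nat) (M : 'M[R]_(m + n))
    (u : 'cV[R]_m) (v : 'cV[R]_n) :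
  M \is symmetricmx ->
  quadform M (col_mx u v) =
  bilinform u (ulsubmx M) u + 2 * bilinform v (dlsubmx M) u
  + bilinform v (drsubmx M) v.
Proof.
(* [symmetricmx] is the hermitian predicate for the sign [(-1) ^+ 0] and the identity map; clearing
   both leaves [M = M^T]. *)
move=> /is_hermitianmxP; rewrite expr0 scale1r map_mx_id // => Msym.
rewrite -[in LHS](submxK M) -[quadform _ _]/(bilinform _ _ _) bilinform_block.
have -> : ursubmx M = (dlsubmx M)^T by rewrite trmx_dlsub -Msym.
rewrite bilinform_tr; lra.
Qed.

Lemma quadform_symblock4 (R : realType) (a b c d : nat)
    (M11 : 'M[R]_a) (M12 : 'M[R]_(a, b)) (M13 : 'M[R]_(a, c)) (M14 : 'M[R]_(a, d))
    (M22 : 'M[R]_b) (M23 : 'M[R]_(b, c)) (M24 : 'M[R]_(b, d))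
    (M33 : 'M[R]_c) (M34 : 'M[R]_(c, d)) (M44 : 'M[R]_d)
    (v1 : 'cV[R]_a) (v2 : 'cV[R]_b) (v3 : 'cV[R]_c) (v4 : 'cV[R]_d) :
  quadform (symblock4 M11 M12 M13 M14 M22 M23 M24 M33 M34 M44)
           (col_mx (col_mx v1 v2) (col_mx v3 v4)) =
  bilinform v1 M11 v1 + bilinform v2 M22 v2
  + bilinform v3 M33 v3 + bilinform v4 M44 v4
  + 2 * (bilinform v1 M12 v2 + bilinform v1 M13 v3 + bilinform v1 M14 v4
         + bilinform v2 M23 v3 + bilinform v2 M24 v4 + bilinform v3 M34 v4).
Proof.
rewrite -[quadform _ _]/(bilinform _ _ _) !bilinform_block !bilinform_tr; lra.
Qed.

(** In block row [i] only the diagonal term survives, and there [conform_mx] is the identity. *)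
Lemma blkdiag_mul_mxcol (R : realType) (N k : nat) (m n : 'I_N -> nat)
    (M : forall i, 'M[R]_(m i, n i)) (v : forall i, 'M[R]_(n i, k)) :
  blkdiag M *m \mxcol_i v i = \mxcol_i (M i *m v i).
Proof.
rewrite mul_mxblock_mxrow; apply: eq_mxcol => i.
rewrite (bigD1 i) //= eqxx conform_mx_id big1 ?addr0 // => j.
by rewrite eq_sym => /negPf ->; rewrite mul0mx.
Qed.

Lemma bilinform_blkdiag (R : realType) (N : nat) (m n : 'I_N -> nat)
    (M : forall i, 'M[R]_(m i, n i))
    (u : forall i, 'cV[R]_(m i)) (v : forall i, 'cV[R]_(n i)) :
  bilinform (\mxcol_i u i) (blkdiag M) (\mxcol_i v i) =
  \sum_i bilinform (u i) (M i) (v i).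
Proof.
rewrite /bilinform -mulmxA blkdiag_mul_mxcol tr_mxcol mul_mxrow_mxcol summxE.
by apply: eq_bigr => i _; rewrite mulmxA.
Qed.

(** Rewrites the weighted local supply rates as the left-hand side bounded in [supply_rate_le]. *)
Lemma sum_quadform_blkdiag (R : realType) (N : nat) (m n : 'I_N -> nat)
    (X : forall i, 'M[R]_(m i + n i)) (p : 'I_N -> R)
    (u : forall i, 'cV[R]_(m i)) (y : forall i, 'cV[R]_(n i)) :
  (forall i, X i \is symmetricmx) ->
  \sum_i p i * quadform (X i) (col_mx (u i) (y i)) =
  bilinform (\mxcol_i u i) (blkdiag (fun i => p i *: ulsubmx (X i)))
            (\mxcol_i u i)
  + 2 * bilinform (\mxcol_i y i) (blkdiag (fun i => p i *: dlsubmx (X i)))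
                  (\mxcol_i u i)
  + bilinform (\mxcol_i y i) (blkdiag (fun i => p i *: drsubmx (X i)))
              (\mxcol_i y i).
Proof.
move=> Xsym; rewrite !bilinform_blkdiag mulr_sumr -!big_split /=.
apply: eq_bigr => i _; rewrite quadform_sym_block // !bilinformZm; lra.
Qed.

(* Here [c] stands for B K y. *)
Lemma supply_rate_le (R : realType) (nw ny : nat)
    (P11 : 'M[R]_nw) (P21 : 'M[R]_(ny, nw)) (P22 : 'M[R]_ny)
    (G11 : 'M[R]_(nw, ny)) (G21 : 'M[R]_ny) (Y : 'M[R]_(nw + ny))
    (c w : 'cV[R]_nw) (y : 'cV[R]_ny) :
  Y \is symmetricmx ->
  psdmx (symblock4 P11 0 G11 P11
                   (- drsubmx Y) (- drsubmx Y) 0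
                   (- symmpart G21 - P22) (- P21 + dlsubmx Y)
                   (ulsubmx Y)) ->
  G11 *m y = P11 *m c -> G21 *m y = P21 *m c ->
  bilinform (c + w) P11 (c + w) + 2 * bilinform y P21 (c + w)
  + bilinform y P22 y <= quadform Y (col_mx w y).
Proof.
move=> Ysym [_ /(_ (col_mx (col_mx (- (c + w)) (- y)) (col_mx y w)))].
move=> + eG11 eG21; rewrite quadform_symblock4 quadform_sym_block //.
have e1 : bilinform (c + w) G11 y = bilinform (c + w) P11 c.
  by rewrite /bilinform -!mulmxA eG11.
have e2 : bilinform y G21 y = bilinform y P21 c.
  by rewrite /bilinform -!mulmxA eG21.
(* The diagonal terms in [P11] and [drsubmx Y] enter with the wrong sign. The minus signs in the
   first two components make the doubled cross terms contribute the same forms with factor 2 and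
   opposite sign, which reverses them. *)
rewrite /symmpart !(bilinformNl, bilinformNr, bilinformNm, bilinformDm).
rewrite !bilinform0m bilinform_tr e1 e2.
(* Only the right argument is split: the left factor [c + w] stays whole, as in [e1] and in the
   cross term with [w], so the rest is linear arithmetic. *)
rewrite [bilinform _ _ (c + w)]bilinformDr [bilinform y _ (c + w)]bilinformDr.
lra.
Qed.

Lemma design_feasible_dissipative (R : realType) (N : nat)
    (nx nu ny : 'I_N -> nat)
    (A : forall i : 'I_N, 'M[R]_(nx i))
    (B : forall i : 'I_N, 'M[R]_(nx i, nu i))
    (C : forall i : 'I_N, 'M[R]_(ny i, nx i))
    (K : forall i : 'I_N, 'M[R]_(nu i, nx i))
    (X : forall i : 'I_N, 'M[R]_(nx i + ny i))
    (Kbar : forall i j : 'I_N, 'M[R]_(nu i, ny j))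
    (Y : 'M[R]_(\sum_i nx i + \sum_i ny i))
    (p : 'I_N -> R) :
  (forall i, X i \is symmetricmx) ->
  (forall i, dissipative (sub_step A B K i) (sub_out C i) (X i)) ->
  design_feasible B X Kbar Y p ->
  dissipative (net_step A B C K (fun i j => (p i)^-1 *: Kbar i j))
              (net_out C) Y.
Proof.
(* Finiteness of ['I_N] allows one storage function per subsystem to be picked simultaneously. *)
move=> Xsym /fin_all_exists [V HV] [Ysym p_gt0 _ LMI].
set Kg := fun i j : 'I_N => _.
(* A nonzero network state may have zero blocks, so the remaining summands need this weak bound. *)
have V_ge0 i x : 0 <= V i x.
  have [V0 Vpos _] := HV i.
  by have [->|/Vpos/ltW //] := eqVneq x 0; rewrite V0.
exists (fun x => \sum_i p i * V i (submxcol x i)); split=> [|x x_neq0|w x xE t].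
- by apply: big1 => i _; rewrite submxcol0; have [-> _ _] := HV i; rewrite mulr0.
- have [i xi_neq0] : exists i, submxcol x i != 0.
    apply/existsP; apply: contraNT x_neq0 => /existsPn x0.
    apply/eqP/mxcolP => i; rewrite submxcol0; apply/eqP.
    by have := x0 i; rewrite negbK.
  have [_ Vpos _] := HV i.
  rewrite (bigD1 i) //= ltr_wpDr ?mulr_gt0 ?Vpos //.
  by apply: sumr_ge0 => j _; rewrite mulr_ge0 // ltW.
(* Blockwise, [c] is B K y, [u] is the subsystem input u~, and [z] is the local output. *)
pose y s := net_out C (x s) (w s).
pose c s i := B i *m net_ctrl Kg i (y s).
pose u s i : 'cV_(nx i) := c s i + submxcol (w s) i.
pose z s i : 'cV_(ny i) := C i *m submxcol (x s) i.
have yE s : y s = \mxcol_i z s i by [].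
have uE s : \mxcol_i u s i = \mxcol_i c s i + w s.
  by rewrite mxcolD submxcolK.
have local_diss i : V i (submxcol (x t.+1) i) - V i (submxcol (x t) i)
    <= quadform (X i) (col_mx (u t i) (z t i)).
  have [_ _ Vdiss] := HV i.
  (* Block [i] of the network trajectory is a trajectory of subsystem [i] driven by [u]. *)
  apply: (Vdiss (u^~ i) (fun s => submxcol (x s) i)) => s.
  by rewrite xE mxcolK.
(* The scalar [p i] commutes with [B i] and cancels the factor [(p i)^-1] in [Kg]. *)
have KbarE i : p i *: c t i = B i *m \sum_j Kbar i j *m z t j.
  rewrite /c /net_ctrl scalemxAr scaler_sumr; congr (_ *m _).
  apply: eq_bigr => j _; rewrite yE mxcolK -scalemxAl scalerA.
  by rewrite divff ?scale1r // gt_eqF.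
(* The row sizes [m] are left free so that this serves both X^{11} and X^{21}. *)
have blk (m : 'I_N -> nat) (M : forall i, 'M[R]_(m i, nx i)) :
    blkdiag M *m blkdiag B *m (\mxblock_(i, j) Kbar i j) *m y t
    = blkdiag (fun i => p i *: M i) *m \mxcol_i c t i.
  rewrite yE -!mulmxA mul_mxblock_mxrow !blkdiag_mul_mxcol.
  by apply: eq_mxcol => i; rewrite -KbarE -scalemxAr scalemxAl.
(* Positive weights preserve the local dissipation inequalities, which are then summed. *)
apply: (@le_trans _ _ (\sum_i p i * quadform (X i) (col_mx (u t i) (z t i)))).
  rewrite -sumrB ler_sum // => i _.
  by rewrite -mulrBr ler_pM2l.
rewrite sum_quadform_blkdiag // uE -yE.
exact: supply_rate_le Ysym LMI (blk _ _) (blk _ _).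
Qed.

Theorem proposition4 (R : realType) (N : nat) (hN : (0 < N)%N)
    (nx nu ny : 'I_N -> nat)
    (A : forall i : 'I_N, 'M[R]_(nx i))
    (B : forall i : 'I_N, 'M[R]_(nx i, nu i))
    (C : forall i : 'I_N, 'M[R]_(ny i, nx i))
    (K : forall i : 'I_N, 'M[R]_(nu i, nx i))
    (X : forall i : 'I_N, 'M[R]_(nx i + ny i))
    (Xsym : forall i : 'I_N, X i \is symmetricmx)
    (X11pos : forall i : 'I_N, posdefmx (ulsubmx (X i)))
    (Xdiss : forall i : 'I_N,
       dissipative (sub_step A B K i) (sub_out C i) (X i))
    (phi : ('I_N -> R) -> R)
    (psi : 'M[R]_(\sum_i nx i + \sum_i ny i) -> R)
    (Kbar : forall i j : 'I_N, 'M[R]_(nu i, ny j))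
    (Y : 'M[R]_(\sum_i nx i + \sum_i ny i))
    (p : 'I_N -> R) :
  let Kg := fun i j : 'I_N => (p i)^-1 *: Kbar i j in
  let closed_loop_dissipative :=
    dissipative (net_step A B C K Kg) (net_out C) Y in
  (design_feasible B X Kbar Y p -> closed_loop_dissipative) /\
  (design_optimal B X phi psi Kbar Y p -> closed_loop_dissipative).
Proof.
move=> Kg closed_loop_dissipative.
have feas : design_feasible B X Kbar Y p -> closed_loop_dissipative.
  exact: design_feasible_dissipative.
(* An optimal triple is in particular feasible. *)
by split=> // -[/feas].
Qed.
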